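(* Let $\alpha_0+\alpha_1+2\alpha_2+2\alpha_3=1$ and consider the system $$\frac{dx}{dt}=\frac{-2x^3y+2x^2y-(\alpha_1+2\alpha_2)x^2-(t-1+2\alpha_3)x+t}{t},$$ $$\frac{dy}{dt}=\frac{3x^2y^2-2xy^2+2(\alpha_1+2\alpha_2)xy+(t-1+2\alpha_3)y+(\alpha_1+\alpha_2)\alpha_2}{t}.$$ Make the change of parameters and variables $$\beta_0=\alpha_2+2\alpha_3,\quad\beta_1=\alpha_1,\quad\beta_2=\alpha_2,\quad\beta_3=\alpha_0,$$ $$X=\frac1x,\quad Y=-x(xy+\alpha_2),\quad T=-t.$$ Then the system can be written in the new variables $T,X,Y$ and parameters $\beta_0,\dots,\beta_3$ as a Hamiltonian system, and this new system is the system of type $A_3^{(1)}$: $$\frac{dX}{dT}=\frac{2X^2Y}{T}+X^2-\frac{2XY}{T}-\Big(1+\frac{\beta_1+\beta_3}{T}\Big)X+\frac{\beta_1}{T},$$ $$\frac{dY}{dT}=-\frac{2XY^2}{T}+\frac{Y^2}{T}-2XY+\Big(1+\frac{\beta_1+\beta_3}{T}\Big)Y-\beta_2,$$ with the Hamiltonian $$H_{A_3^{(1)}}(X,Y,T;\beta_1,\beta_2,\beta_3)=\frac{Y(Y+T)X(X-1)+\beta_2XT-\beta_3XY-\beta_1Y(X-1)}{T}.$$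
   Context: A Hamiltonian system with Hamiltonian $K(X,Y,T)$ means $dX/dT=\partial K/\partial Y$, $dY/dT=-\partial K/\partial X$. *)

(* Defs.v *)
From HB Require Import structures.
From mathcomp Require Import all_boot all_order all_algebra.
From mathcomp Require Import all_classical all_reals all_analysis.

Set Implicit Arguments.
Unset Strict Implicit.
Unset Printing Implicit Defensive.

Import Order.TTheory GRing.Theory Num.Theory.
Import numFieldNormedType.Exports.

Local Open Scope classical_set_scope.
Local Open Scope ring_scope.

(* The scalars K form an arbitrary numFieldType, so that K may be the complex
   field R[i], where [is_derive t 1 f l] means that f is complex-differentiable
   at t with f'(t) = l, as well as the real field. *)

Section PlanarSystems.
Variable K : numFieldType.

(* (u, v) satisfies du/dt = f(u, v, t), dv/dt = g(u, v, t) at every point of D *)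
Definition solves_on (D : set K) (f g : K -> K -> K -> K) (u v : K -> K) :=
  forall t : K, D t ->
    is_derive t (1 : K) u (f (u t) (v t) t) /\
    is_derive t (1 : K) v (g (u t) (v t) t).

(* dX/dT = F(X, Y, T), dY/dT = G(X, Y, T) is, for T != 0, the Hamiltonian
   system with Hamiltonian H: F = dH/dY and G = - dH/dX. *)
Definition is_hamiltonian_system (H F G : K -> K -> K -> K) :=
  forall X Y T : K, T != 0 ->
    is_derive Y (1 : K) (fun Y' : K => H X Y' T) (F X Y T) /\
    is_derive X (1 : K) (fun X' : K => H X' Y T) (- G X Y T).

Definition orig_x (a1 a2 a3 x y t : K) : K :=
  (- 2 * x ^+ 3 * y + 2 * x ^+ 2 * y - (a1 + 2 * a2) * x ^+ 2
   - (t - 1 + 2 * a3) * x + t) / t.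

Definition orig_y (a1 a2 a3 x y t : K) : K :=
  (3 * x ^+ 2 * y ^+ 2 - 2 * x * y ^+ 2 + 2 * (a1 + 2 * a2) * x * y
   + (t - 1 + 2 * a3) * y + (a1 + a2) * a2) / t.

Definition A3_X (b1 b2 b3 X Y T : K) : K :=
  2 * X ^+ 2 * Y / T + X ^+ 2 - 2 * X * Y / T
  - (1 + (b1 + b3) / T) * X + b1 / T.

Definition A3_Y (b1 b2 b3 X Y T : K) : K :=
  - (2 * X * Y ^+ 2 / T) + Y ^+ 2 / T - 2 * X * Y
  + (1 + (b1 + b3) / T) * Y - b2.

Definition H_A3 (X Y T b1 b2 b3 : K) : K :=
  (Y * (Y + T) * X * (X - 1) + b2 * X * T - b3 * X * Y - b1 * Y * (X - 1)) / T.

(* The curves (x, y) over D and (X, Y) over -D correspond under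
   X = 1/x, Y = - x (x y + a2), T = - t. *)
Definition change_of_variables (a2 : K) (D : set K) (x y X Y : K -> K) :=
  forall t : K, D t ->
    X (- t) = 1 / x t /\ Y (- t) = - x t * (x t * y t + a2).

End PlanarSystems.

(* Main.v *)
(* The change of variables is an involution: X = 1/x, Y = - x (x y + a2) gives
   back x = 1/X, y = - X (X Y + a2). Hence a single computation transports
   derivatives in both directions, and both implications reduce to identities
   between rational functions. *)

Require Import Defs.
From HB Require Import structures.
From mathcomp Require Import all_boot all_order all_algebra.
From mathcomp Require Import all_classical all_reals all_analysis.
From mathcomp Require Import ring.

Import Order.TTheory GRing.Theory Num.Theory.
Import numFieldNormedType.Exports.

Local Open Scope classical_set_scope.
Local Open Scope ring_scope.

Lemma is_derive_compN {K : numFieldType} {f : K -> K} {t l : K} :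
  is_derive t 1 f l -> is_derive (- t) 1 (fun s => f (- s)) (- l).
Proof.
(* Writing the base point as [- - t] exhibits it as the image of [- t] under negation, the form in
   which the chain rule applies. *)
rewrite -{1}(opprK t) => -[fd fl].
have fdiff : differentiable f (- - t) by exact/derivable1_diffP.
have Ndiff : differentiable (-%R : K -> K) (- t) by [].
have cdiff : differentiable (f \o -%R) (- t) by exact: differentiable_comp.
apply: (@DeriveDef _ _ _ _ _ (f \o -%R)); first exact/derivable1_diffP.
by rewrite deriveE// diff_comp//= diff_val/= linearN -deriveE// fl.
Qed.

(** Serves the Hamiltonian, which has degree at most two in each of [X] and [Y] separately, so that
    both partial derivatives are read off coefficients. *)
Lemma is_derive_quadratic {K : numFieldType} (a b c : K) {f : K -> K} {z l : K} :
  (forall w, f w = a * w ^+ 2 + b * w + c) -> 2 * a * z + b = l ->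
  is_derive z 1 f l.
Proof.
move=> fE <-.
have idz : is_derive z (1 : K) (id : K -> K) 1 by exact: is_derive_id.
have dq := is_deriveD (is_deriveD (is_deriveZ a (is_deriveM idz idz))
                       (is_deriveZ b idz)) (is_derive_cst c z 1).
have -> : f = a \*: ((id : K -> K) * id) + b \*: (id : K -> K) + cst c.
  by apply/funext => w; rewrite fE expr2.
apply: (is_derive_eq dq).
by rewrite /= /GRing.scale/=; ring.
Qed.

(** From [X = 1/x] one gets [X Y + a = - x y], hence [- X (X Y + a) = y]; negating time twice
    returns to [D]. *)
Lemma change_of_variablesK {K : numFieldType} {a : K} {D : set K}
    {x y X Y : K -> K} :
  (forall t, D t -> x t != 0) ->
  change_of_variables a D x y X Y ->
  change_of_variables a [set - t | t in D] X Y x y.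
Proof.
move=> x0 xyXY _ [t Dt <-]; have [-> ->] := xyXY t Dt.
by rewrite opprK; split; field; rewrite x0.
Qed.

(** The relation is known only on [D]; openness makes it hold near [t], so it can be differentiated.
    The factor -1 from [T = - t] cancels the minus signs in the derivatives of [1/x] and of
    [- (x^2 y + a x)]. *)
Lemma change_of_variables_is_derive {K : numFieldType} {a : K} {D : set K}
    {x y X Y : K -> K} {t p q : K} :
  open D -> D t -> x t != 0 ->
  change_of_variables a D x y X Y ->
  is_derive t 1 x p -> is_derive t 1 y q ->
  is_derive (- t) 1 X (p / x t ^+ 2) /\
  is_derive (- t) 1 Y ((2 * x t * y t + a) * p + x t ^+ 2 * q).
Proof.
move=> oD Dt x0 xyXY dx dy.
have nearD : \forall s \near t, D s by exact: open_nbhs_nbhs.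
split.
- apply: (@near_eq_is_derive _ _ _ (fun s => (x (- s))^-1)).
    apply/nearN; near=> s; rewrite opprK.
    by have [|-> _] := xyXY s; rewrite ?div1r//; near: s.
  have dV : is_derive t 1 (fun s => (x s)^-1) (- x t ^- 2 * p).
    by case: dx => xd <-; apply: DeriveDef; [exact: derivableV|rewrite deriveV].
  apply: (is_derive_eq (is_derive_compN dV)).
  by ring.
- apply: (@near_eq_is_derive _ _ _ (fun s => - x (- s) * (x (- s) * y (- s) + a))).
    apply/nearN; near=> s; rewrite opprK.
    by have [|_ ->] := xyXY s; last by []; near: s.
  have dY := is_deriveM (is_deriveN dx)
               (is_deriveD (is_deriveM dx dy) (is_derive_cst a t 1)).
  apply: (is_derive_eq (is_derive_compN dY)).
  by rewrite !fctE /GRing.scale/=; ring.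
Unshelve. all: by end_near. Qed.

Lemma A3_hamiltonian (K : numFieldType) (b1 b2 b3 : K) :
  is_hamiltonian_system (fun X Y T => H_A3 X Y T b1 b2 b3)
    (A3_X b1 b2 b3) (A3_Y b1 b2 b3).
Proof.
move=> X Y T T0; split.
(* The coefficients are those of [H_A3] collected by powers of [Y]; the second case collects by
   powers of [X]. *)
- apply: (is_derive_quadratic (X * (X - 1) / T)
      (X * (X - 1) - (b3 * X + b1 * (X - 1)) / T) (b2 * X)) => [w|].
    by rewrite /H_A3; field.
  by rewrite /A3_X; field.
- apply: (is_derive_quadratic (Y * (Y + T) / T)
      (b2 - (Y * (Y + T) + b3 * Y + b1 * Y) / T) (b1 * Y / T)) => [w|].
    by rewrite /H_A3; field.
  by rewrite /A3_Y; field.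
Qed.

Theorem theorem1p5 (K : numFieldType) (a0 a1 a2 a3 b0 b1 b2 b3 : K)
  (ha : a0 + a1 + 2 * a2 + 2 * a3 = 1)
  (hb0 : b0 = a2 + 2 * a3) (hb1 : b1 = a1) (hb2 : b2 = a2) (hb3 : b3 = a0) :
  (forall (D : set K) (x y X Y : K -> K),
     open D ->
     (forall t, D t -> t != 0) ->
     (forall t, D t -> x t != 0) ->
     change_of_variables a2 D x y X Y ->
     (solves_on D (orig_x a1 a2 a3) (orig_y a1 a2 a3) x y <->
      solves_on [set - t | t in D] (A3_X b1 b2 b3) (A3_Y b1 b2 b3) X Y)) /\
  is_hamiltonian_system (fun X Y T => H_A3 X Y T b1 b2 b3)
    (A3_X b1 b2 b3) (A3_Y b1 b2 b3) /\
  b0 + b1 + b2 + b3 = 1.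
Proof.
subst b0 b1 b2 b3.
(* Solving the parameter relation for [a0], which enters the new system as [b3], leaves free
   parameters, so the remaining identities hold outright for [ring] and [field]. *)
have a0E : a0 = (a0 + a1 + 2 * a2 + 2 * a3) - a1 - 2 * a2 - 2 * a3 by ring.
rewrite {}ha in a0E; rewrite {}a0E.
split; last by split; [exact: A3_hamiltonian|ring].
move=> D x y X Y oD D0 x0 xyXY; split.
- move=> sol _ [t Dt <-]; have [dx dy] := sol t Dt.
  have [X_t Y_t] := xyXY t Dt.
  have [t0 xt0] := (D0 t Dt, x0 t Dt).
  have [dX dY] := change_of_variables_is_derive oD Dt xt0 xyXY dx dy.
  split; [apply: (is_derive_eq dX)|apply: (is_derive_eq dY)];
    rewrite X_t Y_t /orig_x /orig_y /A3_X /A3_Y; field;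
    by rewrite ?oppr_eq0 t0 xt0.
- move=> sol t Dt; have DNt : [set - t | t in D] (- t) by exists t.
  have [X_t Y_t] := xyXY t Dt.
  have [t0 xt0] := (D0 t Dt, x0 t Dt).
  have Xt0 : X (- t) != 0 by rewrite X_t div1r invr_eq0.
  have [dX dY] := sol _ DNt.
  (* The converse is the same computation with the two pairs of curves exchanged, based at [- t] in
     the reflected domain. *)
  have [] := change_of_variables_is_derive (openN oD) DNt Xt0
               (change_of_variablesK x0 xyXY) dX dY.
  rewrite opprK => dx dy.
  split; [apply: (is_derive_eq dx)|apply: (is_derive_eq dy)];
    rewrite X_t Y_t /orig_x /orig_y /A3_X /A3_Y; field;
    by rewrite ?oppr_eq0 t0 xt0.
Qed.
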